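(* Let $p$ be a prime. If $X$ is a $p$-ary Cayley graph with either $\deg(X) < \kappa(p)$ or $\deg(X) \ge |V(X)| - \kappa(p)$, then the core of $X$ is (isomorphic to) a $p$-ary Cayley graph.
   Context: The function $\kappa$ on primes is defined by $\kappa(2) = 5$, $\kappa(3) = 12$, and $\kappa(p) = 2$ for every prime $p \ge 5$. For an abelian group $A$ (written additively), a connection set is a subset $C \subseteq A \setminus \{0\}$ with $-C = C$. The Cayley graph $\mathrm{Cay}(A, C)$ has vertex set $A$, and $x, y \in A$ are adjacent if and only if $x - y \in C$. A $p$-ary Cayley graph is a Cayley graph on an elementary abelian $p$-group $\mathbb{Z}_p^d$, for some integer $d \ge 0$. $\deg(X)$ is the common degree of all vertices of $X$, and $V(X)$ is the vertex set of $X$. A graph homomorphism is a map of vertices sending adjacent vertices to adjacent vertices; an endomorphism of a graph is a homomorphism from it to itself. A graph is a core if all its endomorphisms are invertible. A core of a graph $X$ is a subgraph of $X$ that is both a retract of $X$ (i.e. there is a homomorphism from $X$ to the subgraph restricting to the identity on the subgraph) and a core; all cores of a given finite graph are isomorphic, so one speaks of the core of $X$. *)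

(* Defs.v *)
From HB Require Import structures.
From mathcomp Require Import all_boot all_algebra.

Set Implicit Arguments.
Unset Strict Implicit.
Unset Printing Implicit Defensive.

Import GRing.Theory.

Record graph := Graph {
  vertex :> finType;
  adj : rel vertex;
  adj_sym : symmetric adj;
  adj_irr : irreflexive adj }.

Arguments adj {g}.

Definition degree (X : graph) (x : X) : nat := #|[set y | adj x y]|.

Definition regular_of_degree (X : graph) (k : nat) : Prop :=
  forall x : X, degree x = k.

Definition graph_hom (X Y : graph) (f : X -> Y) : Prop :=
  forall x y : X, adj x y -> adj (f x) (f y).

Definition isomorphic (X Y : graph) : Prop :=
  exists f : X -> Y, bijective f /\ {mono f : x y / adj x y}.

(* Invertibility is meant in the endomorphism monoid: the inverse map must be
   an endomorphism too. *)
Definition is_core (X : graph) : Prop :=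
  forall f : X -> X, graph_hom f ->
    exists g : X -> X, [/\ graph_hom g, cancel f g & cancel g f].

(* Subgraphs are not assumed to be induced. *)
Record subgraph (X : graph) := Subgraph {
  sub_vertices : {set X};
  sub_adj : rel X;
  sub_adj_sym : symmetric sub_adj;
  sub_adjP : forall x y, sub_adj x y ->
    [/\ x \in sub_vertices, y \in sub_vertices & adj x y] }.

Section GraphOfSubgraph.
Variables (X : graph) (Y : subgraph X).

Let T : finType := {x : X | x \in sub_vertices Y}.
Let e : rel T := fun x y => sub_adj Y (val x) (val y).

Fact subgraph_adj_sym : symmetric e.
Proof. by move=> x y; apply: sub_adj_sym. Qed.

Fact subgraph_adj_irr : irreflexive e.
Proof. by move=> x; apply/negP => /sub_adjP[_ _]; rewrite adj_irr. Qed.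

Definition graph_of_subgraph : graph := Graph subgraph_adj_sym subgraph_adj_irr.
End GraphOfSubgraph.

Coercion graph_of_subgraph : subgraph >-> graph.

Definition is_retract (X : graph) (Y : subgraph X) : Prop :=
  exists r : X -> Y, graph_hom r /\ forall y : Y, r (val y) = y.

Definition is_core_of (X : graph) (Y : subgraph X) : Prop :=
  is_retract Y /\ is_core Y.

Local Open Scope ring_scope.

Record connection_set (A : finZmodType) := ConnectionSet {
  conn :> {set A};
  conn0 : 0 \notin conn;
  connN : [set - x | x in conn] = conn }.

Section Cayley.
Variables (A : finZmodType) (C : connection_set A).

Let e : rel A := fun x y => x - y \in conn C.

Fact cayley_adj_sym : symmetric e.
Proof.
have h x y : e x y -> e y x by move=> xy; rewrite /e -opprB -connN imset_f.
by move=> x y; apply/idP/idP; apply: h.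
Qed.

Fact cayley_adj_irr : irreflexive e.
Proof. by move=> x; rewrite /e subrr (negbTE (conn0 C)). Qed.

Definition Cay : graph := Graph cayley_adj_sym cayley_adj_irr.

Lemma Cay_regular : regular_of_degree Cay #|C|.
Proof.
move=> x; rewrite /degree -(card_imset C (can_inj (subKr x))).
apply: eq_card => y; rewrite inE; apply/idP/imsetP => [xy|[z zC ->]].
  by exists (x - y); rewrite ?subKr.
by rewrite /adj /= /e subKr.
Qed.
End Cayley.

Local Close Scope ring_scope.

(* 'rV['F_p]_d is the group Z_p^d; 'F_p is Z/p only for prime p. *)
Definition pary_cayley_up_to_iso (p : nat) (Y : graph) : Prop :=
  exists (d : nat) (C : connection_set 'rV['F_p]_d), isomorphic Y (Cay C).

(* Only meaningful for prime p. *)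
Definition kappa (p : nat) : nat :=
  if p == 2 then 5 else if p == 3 then 12 else 2.

(* Main.v *)
Require Import Defs.
From mathcomp Require Import all_boot all_algebra.
From mathcomp Require Import zify.

(** Write A for the elementary abelian p-group and D for a connection set in it.
    Call D split if A is a direct sum of subgroups H and K with every nonzero
    element of H in D and no element of K in D.  If D is split, H is a clique
    of Cay(A, D), and the projection A -> A/K = H is a homomorphism to the
    complete graph on H, because its fibres are the cosets of K and contain no
    edge.  A graph that maps to a complete graph and receives a map from it has
    that complete graph as its core ([complete_core]), so the core of
    Cay(A, D) is the complete graph on H, a Cayley graph of an elementary
    abelian p-group ([core_of_splits]).  Being split passes to the
    complement by exchanging H and K ([splits_complement]), so that both cases
    of the theorem reduce to: every connection set with fewer than kappa(p)
    elements is split ([small_connection_splits]).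

    For p >= 5, fewer than two elements means none, since x <> -x for nonzero
    x; then H = 0.  For p = 2, 3, put q = p.  All units of F_q are signs, so D
    is a union of punctured lines, and |D| < kappa(p) = (q - 1)(q + 3) says that
    it represents at most q + 2 points of the projective space.  If some linear
    functional vanishes nowhere on D, take its kernel as K and any line of D as
    H.  Otherwise D meets every hyperplane, and then it contains a punctured
    2-dimensional subspace, as holds for blocking sets of at most q + 2 points
    over any finite field ([functional_or_plane]).  Take that subspace as H.
    It uses q + 1 of the points, so at most one point of D lies outside H, and
    a complement K of H can be chosen to avoid it ([splits_plane]).

    The statement on blocking sets is an induction on D.  Removing one point c,
    one may assume that a functional f vanishes nowhere on the rest and that
    f(c) = 0.  Normalise the rest to a set S of at most q + 1 vectors with
    f = 1.  For a functional g with g(c) = 1, no g - t f vanishes nowhere on D,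
    which says that g takes all q values on S.  Counting the pairs of S on
    which a random such g agrees shows that S must contain a translate of the
    line of c ([shear_cover_fiber]); together with c this translate spans the
    plane sought. *)

Set Implicit Arguments.
Unset Strict Implicit.
Unset Printing Implicit Defensive.
Import GRing.Theory.

(** * Graphs homomorphically equivalent to a complete graph *)

(** The two homomorphisms compose to an endomorphism of the core Y, which is
    therefore an automorphism.  The map K -> Y is injective because K is
    complete and Y has no loops; so Y -> K is a bijection, and it reflects
    adjacency because K -> Y preserves it. *)
Lemma complete_core (X K : graph) (Y : subgraph X) (f : X -> K) (g : K -> X) :
    (forall a b : K, adj a b = (a != b)) -> graph_hom f -> graph_hom g ->
  is_core_of Y -> isomorphic Y K.
Proof.
move=> Kadj fH gH [[r [rH _]] coreY].
have valH : graph_hom (val : Y -> X) by move=> x y /sub_adjP[].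
pose u (y : Y) := f (val y); pose v (a : K) := r (g a).
have uH : graph_hom u by move=> x y /valH/fH.
have vH : graph_hom v by move=> a b /gH/rH.
have [w [_ uvK vuK]] :
    exists w, [/\ graph_hom w, cancel (v \o u) w & cancel w (v \o u)].
  by apply: coreY => x y /uH/vH.
have v_inj : injective v.
  move=> a b eq_v; apply/eqP/negPn/negP; rewrite -Kadj => /vH.
  by rewrite eq_v adj_irr.
have uK : cancel u (w \o v) := uvK.
have vK : cancel (w \o v) u.
  by move=> a; apply: v_inj; apply: (vuK (v a)).
exists u; split; first by exists (w \o v).
move=> x y; apply/idP/idP => [|/uH //]; rewrite Kadj => uxy.
have /vH : adj (u (w x)) (u (w y)).
  rewrite Kadj; apply: contraNneq uxy => /(can_inj uK)/(can_inj vuK) -> //.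
by rewrite -[v (u (w x))]/((v \o u) (w x)) -[v (u (w y))]/((v \o u) (w y)) !vuK.
Qed.

(** * Almost injective surjections *)

Section Collisions.
Variables (T U : finType) (S : {set T}) (h : T -> U).

(** All fibres are nonempty and there is at most one element to spare, so every
    fibre has n = 1 or n = 2 elements, and n ^ 2 = 3 n - 2 for both values.
    The sum counts ordered pairs with equal image, the diagonal included. *)
Lemma collisions_near_bijection :
    (forall t, exists2 x, x \in S & h x = t) -> #|S| <= #|U|.+1 ->
  \sum_(x in S) #|[set y in S | h y == h x]| + 2 * #|U| <= 3 * #|S|.
Proof.
move=> surj leS; pose n t := #|[set y in S | h y == t]|.
have sumn : #|S| = \sum_t n t.
  rewrite -sum1_card (partition_big h xpredT) //.
  apply: eq_bigr => t _; rewrite sum1_card /n.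
  by apply: eq_card => y; rewrite !inE.
have n_gt0 t : 0 < n t.
  have [x xS hx] := surj t.
  by apply/card_gt0P; exists x; rewrite inE xS hx eqxx.
have n_le2 t : n t <= 2.
  have: #|U|.-1 <= \sum_(u | u != t) n u.
    rewrite -(cardC1 t) -sum1_card.
    by rewrite (eq_bigl (fun u => u != t)) ?leq_sum // => u; rewrite !inE.
  by move: leS; rewrite sumn (bigD1 t) //=; lia.
have -> : \sum_(x in S) #|[set y in S | h y == h x]| = \sum_t n t * n t.
  rewrite (partition_big h xpredT) //; apply: eq_bigr => t _.
  rewrite -[RHS]/(n t * _) [in RHS]/n -sum_nat_const.
  by apply: eq_big => [x|x /andP[_ /eqP->] //]; rewrite !inE.
rewrite sumn big_distrr /= -sum1_card big_distrr /= -big_split /=.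
by apply: leq_sum => t _; have := n_gt0 t; have := n_le2 t; nia.
Qed.
End Collisions.

Local Open Scope ring_scope.

(** * Linear functionals *)

Section Pairing.
Variables (F : fieldType) (d : nat).
Implicit Types (x y : 'rV[F]_d) (g h : 'cV[F]_d).

Definition pairing x g : F := (x *m g) 0 0.

Lemma pairingDl x y g : pairing (x + y) g = pairing x g + pairing y g.
Proof. by rewrite /pairing mulmxDl [LHS]mxE. Qed.

Lemma pairingDr x g h : pairing x (g + h) = pairing x g + pairing x h.
Proof. by rewrite /pairing mulmxDr [LHS]mxE. Qed.

Lemma pairingZl a x g : pairing (a *: x) g = a * pairing x g.
Proof. by rewrite /pairing -scalemxAl [LHS]mxE. Qed.

Lemma pairingZr a x g : pairing x (a *: g) = a * pairing x g.
Proof. by rewrite /pairing -scalemxAr [LHS]mxE. Qed.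

(** A column of the cokernel matrix of M on which x does not vanish, rescaled,
    is the functional needed. *)
Lemma separating_functional m (M : 'M[F]_(m, d)) x :
  ~~ (x <= M)%MS -> exists2 g, M *m g = 0 & pairing x g = 1.
Proof.
rewrite submxE => /matrix0Pn[i [j]]; rewrite ord1 => nz.
exists (((x *m cokermx M) 0 j)^-1 *: col j (cokermx M)).
  by rewrite -scalemxAr colE (mulmxA M) mulmx_coker mul0mx scaler0.
by rewrite pairingZr /pairing colE (mulmxA x) -colE [col _ _ _ _]mxE mulVf.
Qed.

Lemma unit_functional x : x != 0 -> exists g, pairing x g = 1.
Proof.
move=> x0; have [|g _ xg] := @separating_functional d 0 x; last by exists g.
by rewrite submx0.
Qed.
End Pairing.

(** * Sets of q + 2 points that meet every hyperplane *)

Section Blocking.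
Variables (F : finFieldType) (d : nat).
Implicit Types (x y c : 'rV[F]_d) (g h : 'cV[F]_d) (S D : {set 'rV[F]_d}).
Local Notation q := #|F|.

Lemma card_field_gt1 : (1 < q)%N.
Proof.
by have := max_card [set (0 : F); 1]; rewrite cards2 eq_sym oner_eq0.
Qed.

Definition normalized c : {set 'cV[F]_d} := [set g | pairing c g == 1].

(** For x and y in different cosets of the line of c, a normalised functional
    agrees on x and y with probability at least 1 / q: translating it along a
    functional that kills c but not y - x corrects the difference. *)
Lemma agreeing_functionals c x y :
    ~~ (y - x <= c)%MS ->
  (#|normalized c|
     <= q * #|[set g in normalized c | pairing y g == pairing x g]|)%N.
Proof.
case/separating_functional => h ch xyh.
set G := normalized c; set G0 := [set g in G | _].
rewrite -cardsT -cardsX; pose sh (p : F * 'cV[F]_d) := p.2 + p.1 *: h.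
apply: leq_trans (leq_imset_card sh _); apply/subset_leq_card/subsetP => g.
rewrite inE => /eqP cg; have cth : pairing c h = 0 by rewrite /pairing ch mxE.
apply/imsetP; exists (pairing (y - x) g, g - pairing (y - x) g *: h); last first.
  by rewrite /sh /= subrK.
have dif u : pairing (y - x) u = pairing y u - pairing x u.
  by rewrite pairingDl -scaleN1r pairingZl mulN1r.
rewrite !inE /= -scaleNr pairingDr pairingZr cg cth mulr0 addr0 eqxx /=.
by rewrite -subr_eq0 -dif pairingDr pairingZr xyh mulr1 subrr eqxx.
Qed.

(** Suppose that S contains no coset of the line of c.  Then each x in S has at
    least #|S| - (q - 1) partners in S in other cosets of that line, and each
    such pair is identified by a fraction 1 / q of the normalised functionals.
    On the other hand S has at most one element more than F, so
    [collisions_near_bijection] bounds the number of pairs that one functional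
    identifies.  The two estimates of the total T contradict each other. *)
Lemma shear_cover_fiber c S :
    (#|S| <= q.+1)%N -> c != 0 ->
    (forall g t, pairing c g = 1 -> exists2 x, x \in S & pairing x g = t) ->
  exists x, forall t, x + t *: c \in S.
Proof.
move=> leS c0 cover.
have [/existsP[x /forallP Sx] | noline] :=
  boolP [exists x, [forall t, x + t *: c \in S]]; first by exists x.
have {noline} gap x : exists t, x + t *: c \notin S.
  move: noline; rewrite negb_exists => /forallP/(_ x).
  by rewrite negb_forall => /existsP.
set G := normalized c.
have G_gt0 : (0 < #|G|)%N.
  by have [g cg] := unit_functional c0; apply/card_gt0P; exists g; rewrite inE cg.
pose T := (\sum_(g in G) \sum_(x in S)
            #|[set y in S | pairing y g == pairing x g]|)%N.
have T_le : (T + #|G| * (2 * q) <= #|G| * (3 * #|S|))%N.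
  rewrite -!sum_nat_const -big_split /=; apply: leq_sum => g.
  rewrite inE => /eqP cg.
  by apply: collisions_near_bijection => // t; apply: cover.
have S_ge : (q <= #|S|)%N.
  have [g cg] := unit_functional c0; rewrite -cardsT.
  apply: leq_trans (leq_imset_card (fun x => pairing x g) S).
  apply/subset_leq_card/subsetP => t _; have [x xS <-] := cover g t cg.
  exact: imset_f.
have T_ge : (#|S| * (#|G| * #|S|.+1) <= q * T)%N.
  have -> : T = (\sum_(x in S) \sum_(y in S)
                  #|[set g in G | pairing y g == pairing x g]|)%N.
    rewrite /T exchange_big /=; apply: eq_bigr => x _.
    under eq_bigr => g _ do rewrite -sum1_card.
    under [RHS]eq_bigr => y _ do rewrite -sum1_card.
    rewrite (exchange_big_dep (mem S)) /=; last first.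
      by move=> g y _; rewrite inE => /andP[].
    by apply: eq_bigr => y yS; apply: eq_bigl => g; rewrite !inE yS.
  rewrite big_distrr /= -sum_nat_const; apply: leq_sum => x xS.
  pose cross := [set y in S | ~~ (y - x <= c)%MS].
  have cross_ge : (#|S| <= #|cross| + q.-1)%N.
    have [t0 St0] := gap x.
    rewrite -(cardsID [set y | ~~ (y - x <= c)%MS] S) leq_add //.
      by apply/subset_leq_card/subsetP => y; rewrite !inE.
    rewrite -(cardC1 t0).
    apply: leq_trans (leq_imset_card (fun t => x + t *: c) _).
    apply/subset_leq_card/subsetP => y; rewrite !inE negbK.
    case/andP=> /sub_rVP[t yx] yS.
    have def_y : y = x + t *: c by rewrite -yx addrC subrK.
    apply/imsetP; exists t => //; rewrite !inE; apply: contraNneq St0 => <-.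
    by rewrite -def_y.
  have crossG y : y \in cross ->
      (#|G| <= q * #|[set g in G | pairing y g == pairing x g]|)%N.
    by rewrite inE => /andP[_]; apply: agreeing_functionals.
  have xcross : x \notin cross by rewrite inE subrr sub0mx andbF.
  have sub : x |: cross \subset S.
    by apply/subsetP => y; rewrite !inE => /orP[/eqP->|/andP[]].
  (* The pair (x, x) is identified by all of G, the cross pairs by a fraction
     1 / q of G; the pairs within a coset are dropped. *)
  rewrite (big_setID (x |: cross)) /= (setIidPr sub) big_setU1 //=.
  have -> : [set g in G | pairing x g == pairing x g] = G.
    by apply/setP => g; rewrite !inE eqxx andbT.
  have crossS : (#|cross| * #|G| <=
      q * \sum_(y in cross) #|[set g in G | pairing y g == pairing x g]|)%N.
    by rewrite big_distrr -sum_nat_const /=; apply: leq_sum.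
  have S_lt : (#|S|.+1 <= #|cross| + q)%N.
    by have := card_field_gt1; lia.
  apply: leq_trans (leq_mul (leqnn _) S_lt) _.
  rewrite mulnDr addnC mulnDr; apply: leq_trans (leq_addr _ _).
  by rewrite mulnDr leq_add // mulnC.
have q_gt1 := card_field_gt1.
have [eqS|eqS] : #|S| = q \/ #|S| = q.+1 by lia.
  by rewrite eqS in T_ge T_le; nia.
by rewrite eqS in T_ge T_le; nia.
Qed.
Definition cone D := forall a x, a != 0 -> x \in D -> a *: x \in D.

Definition ray c := [set a *: c | a in [set~ (0 : F)]].

Lemma card_ray c : c != 0 -> #|ray c| = q.-1.
Proof.
move=> c0; rewrite card_in_imset ?cardsC1 // => a b _ _ /eqP.
by rewrite -subr_eq0 -scalerBl scaler_eq0 (negPf c0) orbF subr_eq0 => /eqP.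
Qed.

Lemma rayZ c a x : a != 0 -> (a *: x \in ray c) = (x \in ray c).
Proof.
move=> a0; apply/imsetP/imsetP => -[b]; rewrite !inE => b0 def_x.
  exists (a^-1 * b); first by rewrite !inE mulf_neq0 ?invr_eq0.
  by rewrite -scalerA -def_x scalerA mulVf ?scale1r.
by exists (a * b); rewrite ?inE ?mulf_neq0 // def_x scalerA.
Qed.

Lemma ray_sub D c : cone D -> c \in D -> ray c \subset D.
Proof.
move=> coneD cD; apply/subsetP => y /imsetP[a].
by rewrite !inE => a0 ->; apply: coneD.
Qed.

(** The bound says that D represents fewer than q + 3 points of the projective
    space.  It cannot be relaxed for q = 2: the five vectors consisting of a
    basis of F_2^4 and its sum meet every hyperplane and contain no punctured
    plane. *)
Lemma functional_or_plane D :
    0 \notin D -> cone D -> (#|D| < q.-1 * (q + 3))%N ->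
  (exists g, forall x, x \in D -> pairing x g != 0) \/
  (exists M : 'M[F]_(1 + 1, d),
     forall v : 'rV_(1 + 1), v != 0 -> v *m M \in D).
Proof.
have [n] := ubnP #|D|; elim: n D => // n IHn D leDn D0 coneD ltD.
have [-> | [c cD]] := set_0Vmem D.
  by left; exists 0 => x; rewrite inE.
have c0 : c != 0 by apply: contraNneq D0 => <-.
have raycD := ray_sub coneD cD.
pose D' := D :\: ray c.
have D'D : {subset D' <= D} by apply/subsetP/subsetDl.
have coneD' : cone D'.
  by move=> a x a0; rewrite !in_setD rayZ // => /andP[-> /(coneD a _ a0)->].
have cardD : (#|D| = q.-1 + #|D'|)%N.
  by rewrite -(cardsID (ray c) D) (setIidPr raycD) card_ray.
have q_gt1 := card_field_gt1.
case: (IHn D') => //; first by lia.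
- by apply: contra D0; apply: D'D.
- by lia.
- case=> f fD'.
  have decD x : x \in D -> x \in D' \/ x \in ray c.
    by rewrite !inE; case: (x \in ray c) => ->; [right | left].
  have [cf | cf] := eqVneq (pairing c f) 0; last first.
    left; exists f => x /decD[/fD' // | /imsetP[a]]; rewrite !inE => a0 ->.
    by rewrite pairingZl mulf_neq0.
  case: (boolP [exists g, [forall x in D, pairing x g != 0]]).
    by case/existsP=> g /forall_inP gD; left; exists g.
  rewrite negb_exists => /forallP blocked; right.
  pose S := [set x in D' | pairing x f == 1].
  have inS x : (x \in S) = (x \in D') && (pairing x f == 1) by rewrite [LHS]inE.
  have leS : (#|S| <= q.+1)%N.
    (* Scaling S by the units gives disjoint parts of D', told apart by f. *)
    have : (q.-1 * #|S| <= #|D'|)%N.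
      rewrite -(cardsC1 (0 : F)) -cardsX.
      pose m (p : F * 'rV[F]_d) := p.1 *: p.2.
      rewrite -(card_in_imset (f := m)).
        apply/subset_leq_card/subsetP => y /imsetP[[a x]].
        by rewrite in_setX in_setC1 inS /= => /and3P[a0 xD' _] ->; apply: coneD'.
      move=> [a x] [b y]; rewrite !in_setX !in_setC1 !inS /m /=.
      move=> /and3P[a0 _ /eqP xf] /and3P[b0 _ /eqP yf] eq_xy.
      have ab : a = b.
        have := congr1 (fun z => pairing z f) eq_xy.
        by rewrite !pairingZl xf yf !mulr1.
      by rewrite -ab in eq_xy *; rewrite (scalerI a0 eq_xy).
    move=> leS; have: (q.-1 * #|S|.+1 < q.-1 * (q + 3))%N by rewrite mulnS; lia.
    by rewrite ltn_mul2l; lia.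
  have [|x Sx] := shear_cover_fiber leS c0.
    (* A zero y of g - t f in D is not on the line of c, where g - t f agrees
       with g and vanishes only at 0; so y rescales to a point of S at which g
       takes the value t. *)
    move=> g t cg; have := blocked (g - t *: f).
    rewrite negb_forall => /existsP[y]; rewrite negb_imply negbK.
    rewrite -scaleNr pairingDr pairingZr mulNr subr_eq0.
    case/andP=> yD /eqP yg; case: (decD y yD) => [yD' | ]; last first.
      case/imsetP=> a; rewrite in_setC1 => a0 def_y.
      move: yg; rewrite def_y !pairingZl cf cg mulr0 mulr0 mulr1 => a00.
      by rewrite a00 eqxx in a0.
    have yf := fD' _ yD'; exists ((pairing y f)^-1 *: y).
      by rewrite inS pairingZl mulVf // eqxx andbT coneD' ?invr_eq0.
    by rewrite pairingZl yg mulrCA mulVf ?mulr1.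
  exists (col_mx c x) => v.
  rewrite -[v]hsubmxK mul_row_col [lsubmx v]mx11_scalar [rsubmx v]mx11_scalar.
  rewrite !mul_scalar_mx.
  set a := lsubmx v 0 0; set b := rsubmx v 0 0 => v0.
  have [b0 | b0] := eqVneq b 0.
    rewrite b0 scale0r addr0; apply: coneD => //.
    by apply: contraNneq v0 => ->; rewrite b0 !raddf0 row_mx0.
  have -> : a *: c + b *: x = b *: (x + (b^-1 * a) *: c).
    by rewrite scalerDr scalerA mulrA mulfV // mul1r addrC.
  by apply: coneD => //; apply: D'D; have := Sx (b^-1 * a); rewrite inS => /andP[].
- by case=> M MD'; right; exists M => v /MD'/D'D.
Qed.

(** * Split connection sets *)

(** The decomposition into H and K is encoded by the projection P onto H along
    K: its image is H and its kernel is K. *)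
Definition splits D := exists P : 'M[F]_d,
  [/\ P *m P = P,
      forall x, x *m P != 0 -> x *m P \in D
    & forall x, x \in D -> x *m P != 0].

Lemma splits_set0 : splits set0.
Proof.
by exists 0; split=> [|x|x]; rewrite ?mulmx0 ?inE ?eqxx.
Qed.

(** The complementary projection exchanges H and K. *)
Lemma splits_complement D : splits D -> splits (~: (0 |: D)).
Proof.
case=> P [PP imP kerP]; exists (1%:M - P).
split=> [|x|x]; rewrite ?mulmxBr ?mulmxBl ?mulmx1 ?mul1mx ?PP.
- by rewrite subrr subr0.
- move=> x0; rewrite !inE negb_or x0; apply/negP => /kerP.
  by rewrite mulmxBl -mulmxA PP subrr eqxx.
- rewrite !inE subr_eq0 => /norP[x0 xD]; apply: contraNneq xD => xP.
  by rewrite xP imP // -xP.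
Qed.

Lemma splits_factor r (M : 'M[F]_(r, d)) (N : 'M[F]_(d, r)) D :
    M *m N = 1%:M -> (forall v : 'rV_r, v != 0 -> v *m M \in D) ->
    (forall x, x \in D -> x *m N != 0) ->
  splits D.
Proof.
move=> MN imM kerN; exists (N *m M); split=> [|x|x].
- by rewrite mulmxA -(mulmxA N) MN mulmx1.
- by rewrite mulmxA => x0; apply: imM; apply: contraNneq x0 => ->; rewrite mul0mx.
- move/kerN; apply: contraNneq => /(congr1 (mulmx^~ N)).
  by rewrite mul0mx mulmxA -mulmxA MN mulmx1 => ->.
Qed.

(** A nowhere vanishing functional splits D: any line of D is a complement of
    its kernel. *)
Lemma splits_functional D g :
  cone D -> (forall x, x \in D -> pairing x g != 0) -> splits D.
Proof.
move=> coneD gD; have [-> | [c cD]] := set_0Vmem D; first exact: splits_set0.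
have cg := gD c cD.
apply: (@splits_factor 1 c ((pairing c g)^-1 *: g)) => [|v v0|x xD].
- by rewrite -scalemxAr (mx11_scalar (c *m g)) scale_scalar_mx mulVf.
- rewrite [v]mx11_scalar mul_scalar_mx; apply: coneD => //.
  by apply: contraNneq v0 => v0; rewrite [v]mx11_scalar v0 raddf0.
- rewrite -scalemxAr scaler_eq0 invr_eq0 (negPf cg) /=.
  by apply: contraNneq (gD x xD) => xg; rewrite /pairing xg mxE.
Qed.

(** The plane H accounts for q + 1 of the at most q + 2 points of D, so the part
    of D outside H consists of at most one punctured line.  A projection onto H
    can be corrected, by a functional that vanishes on H, so as not to kill
    that line. *)
Lemma splits_plane D (M : 'M[F]_(1 + 1, d)) :
    0 \notin D -> cone D -> (#|D| < q.-1 * (q + 3))%N ->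
    (forall v : 'rV_(1 + 1), v != 0 -> v *m M \in D) ->
  splits D.
Proof.
move=> D0 coneD ltD MD.
have injM (v : 'rV_(1 + 1)) : v *m M = 0 -> v = 0.
  by move=> vM; apply: contraNeq D0 => /MD; rewrite vM.
have freeM := inj_row_free injM; have MN := mulmxVp freeM.
pose H := [set v *m M | v in [set~ (0 : 'rV[F]_(1 + 1))]].
have HD : H \subset D.
  by apply/subsetP => y /imsetP[v]; rewrite !inE => v0 ->; apply: MD.
have cardH : #|H| = (q ^ 2).-1.
  rewrite card_imset; last exact: row_free_inj.
  by rewrite cardsC1 card_mx.
have q_gt1 := card_field_gt1.
have coneR : cone (D :\: H).
  move=> a x a0; rewrite !inE => /andP[xH xD]; rewrite coneD // andbT.
  apply: contra xH => /imsetP[v]; rewrite !inE => v0 ax; apply/imsetP.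
  exists (a^-1 *: v); first by rewrite !inE scaler_eq0 invr_eq0 negb_or a0.
  by rewrite -scalemxAl -ax scalerA mulVf ?scale1r.
have one_ray e x : e \in D :\: H -> x \in D :\: H -> x \in ray e.
  move=> eR xR; apply/negPn/negP => xe.
  have nz y : y \in D :\: H -> y != 0.
    by rewrite inE => /andP[_ yD]; apply: contraNneq D0 => <-.
  have disj : ray e :&: ray x = set0.
    apply/setP => y; rewrite !inE; apply/negP => /andP[ye].
    case/imsetP=> a; rewrite !inE => a0 def_y; move: ye; rewrite def_y rayZ //.
    by apply/negP.
  have : (#|ray e :|: ray x| <= #|D :\: H|)%N.
    by rewrite subset_leq_card // subUset !ray_sub.
  rewrite cardsU disj cards0 subn0 !card_ray ?nz //.
  move: ltD; rewrite -(cardsID H D) (setIidPr HD) cardH expnS expn1.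
  by move: #|D :\: H| #|F| q_gt1 => n [//|k] _ /=; nia.
have dec x : x \in D -> (exists2 v, v != 0 & x = v *m M) \/ x \in D :\: H.
  move=> xD; rewrite inE xD andbT; case: (boolP (x \in H)); last by right.
  by case/imsetP=> v; rewrite !inE => v0 ->; left; exists v.
case: (set_0Vmem (D :\: H)) => [R0 | [e eR]].
  apply: (splits_factor MN MD) => x /dec[[v v0 ->] | ]; last by rewrite R0 inE.
  by rewrite -mulmxA MN mulmx1.
have [eH eD] : e \notin H /\ e \in D by move: eR; rewrite inE => /andP.
have [g Mg eg] : exists2 g, M *m g = 0 & pairing e g = 1.
  apply: separating_functional; apply: contra eH => /submxP[v ev].
  apply/imsetP; exists v; rewrite ?inE //; apply: contraNneq D0 => v0.
  by rewrite -(mul0mx 1 M) -v0 -ev.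
(* The corrected projection sends e to u; any nonzero u would do. *)
pose u : 'rV[F]_(1 + 1) := const_mx 1.
have u0 : u != 0.
  by apply/eqP => /rowP/(_ 0)/eqP; rewrite !mxE oner_eq0.
apply: (@splits_factor _ M (pinvmx M + g *m (u - e *m pinvmx M))) => //.
  by rewrite mulmxDr MN mulmxA Mg mul0mx addr0.
move=> x /dec[[v v0 ->] | /(one_ray e x eR)/imsetP[a]].
  by rewrite -mulmxA mulmxDr MN mulmxA Mg mul0mx addr0 mulmx1.
rewrite !inE => a0 ->; rewrite -scalemxAl mulmxDr mulmxA.
rewrite (mx11_scalar (e *m g)) -/(pairing e g) eg mul1mx addrC subrK.
by rewrite scaler_eq0 negb_or a0.
Qed.
Lemma small_cone_splits D :
  0 \notin D -> cone D -> (#|D| < q.-1 * (q + 3))%N -> splits D.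
Proof.
move=> D0 coneD ltD.
have [[g gD] | [M MD]] := functional_or_plane D0 coneD ltD.
  exact: splits_functional coneD gD.
exact: splits_plane D0 coneD ltD MD.
Qed.
End Blocking.

(** * Cayley graphs *)

Section CompleteCayley.
Variable A : finZmodType.

Fact nonzero_conn0 : 0 \notin [set~ (0 : A)].
Proof. by rewrite !inE eqxx. Qed.

Fact nonzero_connN : [set - x | x in [set~ (0 : A)]] = [set~ 0].
Proof.
apply/setP => x; rewrite !inE; apply/imsetP/idP => [[y]|x0].
  by rewrite !inE => y0 ->; rewrite oppr_eq0.
by exists (- x); rewrite ?opprK // !inE oppr_eq0.
Qed.

Definition nonzero_conn : connection_set A :=
  ConnectionSet nonzero_conn0 nonzero_connN.

Lemma Cay_nonzero_adj (x y : Cay nonzero_conn) : adj x y = (x != y).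
Proof. by rewrite /adj /= !inE subr_eq0. Qed.

Fact complement_conn0 (C : connection_set A) : 0 \notin ~: (0 |: C).
Proof. by rewrite !inE eqxx. Qed.

Lemma memN_conn (C : connection_set A) x : (- x \in C) = (x \in C).
Proof.
suff sub y : y \in C -> - y \in C.
  by apply/idP/idP => /sub //; rewrite opprK.
by move=> yC; rewrite -connN imset_f.
Qed.

Fact complement_connN (C : connection_set A) :
  [set - x | x in ~: (0 |: C)] = ~: (0 |: C).
Proof.
apply/setP => x; rewrite !inE; apply/imsetP/idP => [[y]|x0].
  by rewrite !inE => y0 ->; rewrite oppr_eq0 memN_conn.
by exists (- x); rewrite ?opprK // !inE oppr_eq0 memN_conn.
Qed.

Definition complement_conn (C : connection_set A) : connection_set A :=
  ConnectionSet (complement_conn0 C) (complement_connN C).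

Lemma complement_connK (C : connection_set A) :
  ~: (0 |: complement_conn C) = C.
Proof.
apply/setP => x; rewrite !inE negb_or negbK.
by case: eqVneq => //= ->; rewrite (negPf (conn0 C)).
Qed.

Lemma card_complement_conn (C : connection_set A) :
  (#|C| + #|complement_conn C|).+1 = #|A|.
Proof. by rewrite -(cardsC (0 |: C)) cardsU1 conn0. Qed.
End CompleteCayley.

(** For the projection P, the row and column bases are mutually inverse
    coordinates on its image; they give the homomorphisms from and to the
    complete graph on F^r, r the rank of P. *)
Lemma core_of_splits (F : finFieldType) d (C : connection_set 'rV[F]_d)
    (Y : subgraph (Cay C)) :
  splits C -> is_core_of Y ->
  exists r, isomorphic Y (Cay (nonzero_conn 'rV[F]_r)).
Proof.
case=> P [PP imP kerP] coreY; exists (\rank P).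
have freeP := row_base_free P; have fullP := col_base_full P.
have MN : row_base P *m col_base P = 1%:M.
  apply: (row_free_inj freeP); apply: (row_full_inj fullP).
  by rewrite mul1mx -mulmxA mulmxA !mulmx_base.
have fixP : row_base P *m P = row_base P.
  have := congr1 (mulmx (row_base P)) (mulmx_base P).
  by rewrite mulmxA MN mul1mx.
pose K := Cay (nonzero_conn 'rV[F]_(\rank P)).
pose f (x : Cay C) : K := (x : 'rV[F]_d) *m col_base P.
pose g (v : K) : Cay C := (v : 'rV[F]_(\rank P)) *m row_base P.
apply: (complete_core (f := f) (g := g)) => //.
- exact: Cay_nonzero_adj.
- move=> x y xyC; rewrite Cay_nonzero_adj -subr_eq0 -mulmxBl.
  apply: contraNneq (kerP _ xyC) => xyN.
  have -> : (x - y) *m P = (x - y) *m col_base P *m row_base P.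
    by rewrite -mulmxA mulmx_base.
  by rewrite xyN mul0mx.
- move=> v w; rewrite Cay_nonzero_adj => vw; rewrite /adj /= -mulmxBl -fixP mulmxA.
  by apply: imP; rewrite -mulmxA fixP mulmx_free_eq0 // subr_eq0.
Qed.

(** All units of F_2 and F_3 are signs. *)
Lemma connection_cone p d (C : connection_set 'rV['F_p]_d) :
  p = 2 \/ p = 3 -> cone C.
Proof.
move=> p23 a x a0 xC.
have [->|->] : a = 1 \/ a = -1; [|by rewrite scale1r|by rewrite scaleN1r memN_conn].
case: p23 => p_eq; subst p; move: a a0 {xC} => [[|[|[|]]] //= lta] _.
- by left; apply: val_inj.
- by left; apply: val_inj.
- by right; apply: val_inj.
Qed.

(** For p = 2, 3 the bound kappa(p) equals (p - 1) (p + 3).  For other primes it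
    is 2, and a nonempty connection set contains some x and -x, which differ
    because p is odd. *)
Lemma small_connection_splits p d (D : connection_set 'rV['F_p]_d) :
  prime p -> (#|D| < kappa p)%N -> splits D.
Proof.
move=> p_prime; rewrite /kappa => ltD.
have [p23 | p23] : (p = 2 \/ p = 3) \/ p != 2 /\ p != 3 by lia.
  apply: small_cone_splits (conn0 D) (connection_cone (C := D) p23) _.
  by rewrite card_Fp //; move: #|D| ltD => n; case: p23 => ->.
suff -> : (D : {set _}) = set0 by apply: splits_set0.
case: p23 => p2 p3; rewrite (negPf p2) (negPf p3) in ltD.
apply/eqP; apply: contraLR ltD => /set0Pn[x xD]; rewrite -leqNgt.
have xNx : x != - x.
  apply: contraNneq (conn0 D) => xx; suff <- : x = 0 by [].
  have /eqP : (2%:R : 'F_p) *: x = 0 by rewrite scaler_nat mulr2n {2}xx subrr.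
  rewrite scaler_eq0 => /orP[|/eqP//]; rewrite -(dvdn_pcharf (pchar_Fp p_prime)).
  by rewrite dvdn_prime2 ?(negPf p2).
have <- : #|[set x; - x]| = 2%N by rewrite cards2 xNx.
apply/subset_leq_card/subsetP => y.
by rewrite !inE => /orP[] /eqP->; rewrite ?memN_conn.
Qed.
Local Close Scope ring_scope.

(* The bound k >= #|V(X)| - kappa p is written without truncated subtraction. *)
Theorem corollary1p4 (p : nat) (p_prime : prime p) (d : nat)
    (C : connection_set 'rV['F_p]_d) (k : nat)
    (degX : regular_of_degree (Cay C) k)
    (hk : k < kappa p \/ #|Cay C| <= k + kappa p)
    (Y : subgraph (Cay C)) (coreY : is_core_of Y) :
  pary_cayley_up_to_iso p Y.
Proof.
have kC : k = #|C| by rewrite -(degX 0%R) Cay_regular.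
suff splitC : splits C.
  have [r isoY] := core_of_splits splitC coreY.
  by exists r, (nonzero_conn 'rV['F_p]_r).
case: hk => [|]; rewrite kC => hk; first exact: small_connection_splits.
(* The nonneighbours of 0 form a connection set with fewer than kappa p
   elements. *)
rewrite -(complement_connK C); apply: splits_complement.
apply: small_connection_splits => //.
have cardX : (#|C| + #|complement_conn C|).+1 = #|Cay C|.
  exact: card_complement_conn.
by rewrite -cardX -addnS leq_add2l in hk.
Qed.
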